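(* Let $\{\mathcal{A},G,\sigma,\alpha\}$ be a $G$-crossed system with $G\neq\{e\}$ and $\mathcal{A}$ an integral domain. Then $\sigma_g\neq\mathrm{id}_{\mathcal{A}}$ for all $g\in G\setminus\{e\}$ if and only if $\tilde{\mathcal{A}}$ is maximal commutative in $\mathcal{A}\rtimes_\alpha^\sigma G$.
   Context: A $G$-crossed system is a quadruple $\{\mathcal{A},G,\sigma,\alpha\}$ consisting of a unital associative ring $\mathcal{A}$, a group $G$ with unit $e$, a map $\sigma:G\to\mathrm{Aut}(\mathcal{A})$, $x\mapsto\sigma_x$, into the ring automorphisms of $\mathcal{A}$, and a map $\alpha:G\times G\to U(\mathcal{A})$ into the group of invertible elements of $\mathcal{A}$, such that for all $x,y,z\in G$, $a\in\mathcal{A}$: (i) $\sigma_x(\sigma_y(a))=\alpha(x,y)\,\sigma_{xy}(a)\,\alpha(x,y)^{-1}$; (ii) $\alpha(x,y)\,\alpha(xy,z)=\sigma_x(\alpha(y,z))\,\alpha(x,yz)$; (iii) $\alpha(x,e)=\alpha(e,x)=1_{\mathcal{A}}$. The crossed product $\mathcal{A}\rtimes_\alpha^\sigma G$ is the free left $\mathcal{A}$-module with basis $\{\overline{g}: g\in G\}$ (a copy of $G$), made into an associative unital ring by the biadditive multiplication determined by $(a_1\overline{x})(a_2\overline{y})=a_1\sigma_x(a_2)\,\alpha(x,y)\,\overline{xy}$. Its elements are formal sums $\sum_{g\in G}a_g\overline{g}$ with $a_g\in\mathcal{A}$, all but finitely many zero. $\tilde{\mathcal{A}}=\{a\overline{e}\mid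 a\in\mathcal{A}\}$ is the embedded copy of $\mathcal{A}$, and $\mathrm{Comm}(\tilde{\mathcal{A}})=\{b\in\mathcal{A}\rtimes_\alpha^\sigma G\mid ab=ba\ \forall a\in\tilde{\mathcal{A}}\}$. ''$\tilde{\mathcal{A}}$ is maximal commutative in $\mathcal{A}\rtimes_\alpha^\sigma G$'' means $\mathrm{Comm}(\tilde{\mathcal{A}})=\tilde{\mathcal{A}}$. An integral domain is a commutative unital ring with $0\neq1$ in which the product of any two non-zero elements is non-zero. *)

(* Defs.v *)
From HB Require Import structures.
From mathcomp Require Import all_boot all_order all_algebra.
From mathcomp Require Import finmap monalg.

Set Implicit Arguments.
Unset Strict Implicit.
Unset Printing Implicit Defensive.

Import GRing.Theory.

Local Open Scope fset_scope.
Local Open Scope ring_scope.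

(* Ring automorphisms of A are bijective ring morphisms, and U(A) is the set
   GRing.unit.  The ring A need not be commutative. *)
Record crossed_system (A : unitRingType) (G : groupType) := CrossedSystem {
  sigma : G -> {rmorphism A -> A};
  alpha : G -> G -> A;
  sigma_bij : forall x : G, bijective (sigma x);
  alpha_unit : forall x y : G, alpha x y \is a GRing.unit;
  sigma_sigma : forall (x y : G) (a : A),
    sigma x (sigma y a) = alpha x y * sigma (x * y)%g a * (alpha x y)^-1;
  alpha_cocycle : forall x y z : G,
    alpha x y * alpha (x * y)%g z = sigma x (alpha y z) * alpha x (y * z)%g;
  alpha_g1 : forall x : G, alpha x 1%g = 1;
  alpha_1g : forall x : G, alpha 1%g x = 1
}.

(* {malg A[G]} is the free left A-module on G (finitely supported maps from G
   to A); << a *g x >> is the element a x-bar, and f@_x is the coefficient of f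
   at x.  G is only used as a basis here: groupType carries no monomType
   structure, so the product below is the only one available. *)
Definition crossed_product (A : unitRingType) (G : groupType)
  (S : crossed_system A G) : Type := {malg A[G]}.

Section CrossedProduct.
Variables (A : unitRingType) (G : groupType) (S : crossed_system A G).

Local Notation sigma := (sigma S).
Local Notation alpha := (alpha S).

HB.instance Definition _ := GRing.Lmodule.copy (crossed_product S) {malg A[G]}.

Implicit Types (f g h : {malg A[G]}) (x y z : G) (a b c : A).

Definition cp_term f g x y : {malg A[G]} :=
  << f@_x * sigma x g@_y * alpha x y *g (x * y)%g >>.

Definition cp_mul f g : {malg A[G]} :=
  \sum_(x <- msupp f) \sum_(y <- msupp g) cp_term f g x y.

Definition cp_one : {malg A[G]} := << 1 *g 1%g >>.

Lemma cp_mulw (d1 d2 : {fset G}) f g : msupp f `<=` d1 -> msupp g `<=` d2 ->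
  cp_mul f g = \sum_(x <- d1) \sum_(y <- d2) cp_term f g x y.
Proof.
move=> le1 le2; rewrite /cp_mul (big_fset_incl _ le1) /=.
  apply/eq_bigr=> x _; apply/big_fset_incl => // y _ /mcoeff_outdom gy.
  by rewrite /cp_term gy rmorph0 mulr0 mul0r monalgU0.
move=> x _ /mcoeff_outdom fx; rewrite big1 // => y _.
by rewrite /cp_term fx !mul0r monalgU0.
Qed.

Lemma cp_mulDl : left_distributive cp_mul +%R.
Proof.
move=> f g h; set d := msupp f `|` msupp g.
have lef : msupp f `<=` d by apply: fsubsetUl.
have leg : msupp g `<=` d by apply: fsubsetUr.
rewrite (cp_mulw lef (fsubset_refl _)) (cp_mulw leg (fsubset_refl _)).
rewrite (cp_mulw (msuppD_le _ _) (fsubset_refl _)).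
rewrite -big_split /=; apply/eq_bigr=> x _.
rewrite -big_split /=; apply/eq_bigr=> y _.
by rewrite /cp_term mcoeffD !mulrDl monalgUD.
Qed.

Lemma cp_mulDr : right_distributive cp_mul +%R.
Proof.
move=> h f g; set d := msupp f `|` msupp g.
have lef : msupp f `<=` d by apply: fsubsetUl.
have leg : msupp g `<=` d by apply: fsubsetUr.
rewrite (cp_mulw (fsubset_refl _) lef) (cp_mulw (fsubset_refl _) leg).
rewrite (cp_mulw (fsubset_refl _) (msuppD_le _ _)).
rewrite -big_split /=; apply/eq_bigr=> x _.
rewrite -big_split /=; apply/eq_bigr=> y _.
by rewrite /cp_term mcoeffD rmorphD mulrDr mulrDl monalgUD.
Qed.

Lemma cp_mul0g : left_zero 0 cp_mul.
Proof. by move=> g; rewrite /cp_mul msupp0 big_seq_fset0. Qed.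

Lemma cp_mulg0 : right_zero 0 cp_mul.
Proof.
by move=> g; rewrite /cp_mul msupp0 big1 // => x _; rewrite big_seq_fset0.
Qed.

Lemma cp_mulUU a b x y :
  cp_mul << a *g x >> << b *g y >> = << a * sigma x b * alpha x y *g (x * y)%g >>.
Proof.
by rewrite (cp_mulw msuppU_le msuppU_le) !big_seq_fset1 /cp_term !mcoeffUU.
Qed.

Lemma cp_mul_suml (I : Type) (r : seq I) (F : I -> {malg A[G]}) g :
  cp_mul (\sum_(i <- r) F i) g = \sum_(i <- r) cp_mul (F i) g.
Proof.
exact: (big_morph (cp_mul^~ g) (fun _ _ => cp_mulDl _ _ _) (cp_mul0g _)).
Qed.

Lemma cp_mul_sumr (I : Type) (r : seq I) (F : I -> {malg A[G]}) f :
  cp_mul f (\sum_(i <- r) F i) = \sum_(i <- r) cp_mul f (F i).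
Proof.
exact: (big_morph (cp_mul f) (fun _ _ => cp_mulDr _ _ _) (cp_mulg0 _)).
Qed.

Lemma sigma1 a : sigma 1%g a = a.
Proof.
apply: (bij_inj (sigma_bij S 1%g)).
by rewrite sigma_sigma mulg1 alpha_1g invr1 mul1r mulr1.
Qed.

Lemma cp_mul1g : left_id cp_one cp_mul.
Proof.
move=> g; rewrite [in LHS](monalgE g) cp_mul_sumr [RHS]monalgE.
by apply/eq_bigr=> x _; rewrite cp_mulUU sigma1 alpha_1g mulr1 !mul1r mul1g.
Qed.

Lemma cp_mulg1 : right_id cp_one cp_mul.
Proof.
move=> g; rewrite [in LHS](monalgE g) cp_mul_suml [RHS]monalgE.
by apply/eq_bigr=> x _; rewrite cp_mulUU rmorph1 alpha_g1 !mulr1 mulg1.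
Qed.

Lemma cp_mulA : associative cp_mul.
Proof.
move=> f g h; rewrite (monalgE f) !cp_mul_suml; apply/eq_bigr=> x _.
rewrite (monalgE g) !(cp_mul_suml, cp_mul_sumr); apply/eq_bigr=> y _.
rewrite (monalgE h) !cp_mul_sumr; apply/eq_bigr=> z _.
rewrite !cp_mulUU mulgA; congr << _ *g _ >>.
rewrite !rmorphM sigma_sigma -!mulrA -alpha_cocycle.
by rewrite mulKr ?alpha_unit.
Qed.

Lemma cp_one_neq0 : cp_one != 0.
Proof. by rewrite monalgU_eq0 oner_eq0. Qed.

HB.instance Definition _ := GRing.Zmodule_isNzRing.Build (crossed_product S)
  cp_mulA cp_mul1g cp_mulg1 cp_mulDl cp_mulDr cp_one_neq0.

Definition base_ring (u : crossed_product S) : Prop :=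
  exists a : A, u = << a *g 1%g >>.

End CrossedProduct.

Arguments base_ring {A G} S _.

Definition commutant (R : nzRingType) (P : R -> Prop) (b : R) : Prop :=
  forall a : R, P a -> a * b = b * a.

Definition maximal_commutative (R : nzRingType) (P : R -> Prop) : Prop :=
  forall b : R, commutant P b <-> P b.

(* Main.v *)
Require Import Defs.
From HB Require Import structures.
From mathcomp Require Import all_boot all_order all_algebra.
From mathcomp Require Import finmap monalg.

(** Multiplying [b] by a scalar [a] of the base ring acts coefficientwise: on
    the left it sends the coefficient [b_x] to [a * b_x], on the right to
    [b_x * sigma_x(a)], the cocycle being trivial when one argument is the unit
    of [G].  Hence [b] centralizes the base ring if and only if
    [b_x * sigma_x(a) = a * b_x] for all [x] and [a] ([commutant_base_ringP]).
    Over an integral domain this says that [sigma_x] is the identity for every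
    [x] in the support of [b].  So if only [sigma_1] is the identity, then [b]
    is supported at the unit of [G], that is, [b] lies in the base ring; and if
    [sigma_g] is the identity for some [g] other than the unit, then the basis
    element of [g] centralizes the base ring without belonging to it. *)

Import GRing.Theory.
Local Open Scope ring_scope.

Section BaseRing.
Variables (A : unitRingType) (G : groupType) (S : crossed_system A G).
Implicit Types (a : A) (x : G) (b : crossed_product S).

(** Multiplication by a scalar does not move the basis elements, as [1 * y = y],
    and both [sigma_1] and [alpha(1, y)] are trivial. *)
Lemma mcoeff_base_mul a b x :
  ((<< a *g 1%g >> : crossed_product S) * b : {malg A[G]})@_x
  = a * (b : {malg A[G]})@_x.
Proof.
rewrite -[_ * b]/(cp_mul S _ _) [in LHS](monalgE b) cp_mul_sumr.
rewrite [in RHS](monalgE b) !raddf_sum mulr_sumr; apply: eq_bigr => y _ /=.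
by rewrite cp_mulUU sigma1 alpha_1g mulr1 mul1g !mcoeffU mulrnAr.
Qed.

Lemma mcoeff_mul_base a b x :
  (b * (<< a *g 1%g >> : crossed_product S) : {malg A[G]})@_x
  = (b : {malg A[G]})@_x * sigma S x a.
Proof.
rewrite -[b * _]/(cp_mul S _ _) [in LHS](monalgE b) cp_mul_suml.
rewrite [in RHS](monalgE b) !raddf_sum mulr_suml; apply: eq_bigr => y _ /=.
rewrite cp_mulUU alpha_g1 mulr1 mulg1 !mcoeffU mulrnAl.
by case: eqP => [->|].
Qed.

(** Both products with a scalar are known coefficient by coefficient, and
    the basis elements of [G] are independent, so commutation splits into one
    condition for each [x]; [A] may be noncommutative here. *)
Lemma commutant_base_ringP b :
  commutant (base_ring S) b <->
  (forall x a, (b : {malg A[G]})@_x * sigma S x a = a * (b : {malg A[G]})@_x).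
Proof.
split=> [bC x a | bC _ [a ->]].
  by rewrite -mcoeff_base_mul -mcoeff_mul_base bC //; exists a.
by apply/malgP => x; rewrite mcoeff_base_mul mcoeff_mul_base bC.
Qed.

Lemma base_ringP b :
  base_ring S b <-> (forall x, x <> 1%g -> (b : {malg A[G]})@_x = 0).
Proof.
split=> [[a ->] x /eqP x1 | b0].
  by rewrite mcoeffU eq_sym (negPf x1).
exists (b : {malg A[G]})@_1%g; apply/malgP => x; rewrite mcoeffU.
by case: eqP => [<- // | /nesym/b0].
Qed.

End BaseRing.

Theorem corollary4p8 (A : idomainType) (G : groupType) (S : crossed_system A G)
    (G_nontrivial : exists g : G, g <> 1%g) :
  (forall g : G, g <> 1%g -> ~ (sigma S g =1 id)) <->
  maximal_commutative (base_ring S).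
Proof.
split=> [sigma_neq b | maxA g g1 sg].
  rewrite commutant_base_ringP base_ringP; split=> [bC x x1 | b0 x a].
    have [// | bx0] := eqVneq (b : {malg A[G]})@_x 0.
    (* a nonzero coefficient at [x] can be cancelled, forcing [sigma_x] = id *)
    case: (sigma_neq x x1) => a; apply: (mulfI bx0).
    by rewrite bC mulrC.
  have [-> | /eqP/b0 ->] := eqVneq x 1%g; last by rewrite mul0r mulr0.
  by rewrite sigma1 mulrC.
have /base_ringP/(_ g g1) : base_ring S (<< 1 *g g >> : {malg A[G]}).
  apply: (proj1 (maxA _)); apply/commutant_base_ringP => x a.
  rewrite mcoeffU; case: eqP => [<- | _]; last by rewrite mul0r mulr0.
  by rewrite sg mulrC.
by rewrite mcoeffUU => /eqP; rewrite oner_eq0.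
Qed.
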